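(* Let $\mu\in C(P,\mathbb{R})$ have compact support $P_\mu\subset P$. Let $\alpha_2>0$ and $\beta_2<0$ and assume that the set $$Q=\{(\alpha,\beta)\in P_\mu\cap P_\gamma:\ 0\le\alpha\le\alpha_2,\ \beta_2\le\beta\le 0\}$$ is non-empty and that $\mu(\alpha,\beta)\ge 0$ for every $(\alpha,\beta)\in Q$. Let the initial interface $I_0\in\mathcal{I}_\gamma$ be such that for every $(\alpha,\beta)\in I_0$ we have $\alpha\ge\alpha_2$ whenever $\beta<\beta_2$, and $\beta\le\beta_2$ whenever $\alpha>\alpha_2$. Let $(w_k)_{k\in\mathbb{Z}_+}$ be a sequence of pulse amplitudes with $w_k\in[\beta_2,\alpha_2]$ for every $k\in\mathbb{Z}_+$. Then for every $k\in\mathbb{Z}_+$, with $\Delta_k\gamma=\gamma(w_{k+1},I_{k+1})-\gamma(w_k,I_k)$ and $\Delta_kw=w_{k+1}-w_k$, $$0\le\frac{\Delta_k\gamma}{\Delta_k w}\le\max\{\Gamma_{2_+}^Q,\Gamma_{1_-}^Q\}\qquad\text{when }\Delta_k w\ne 0,$$ where $$\Gamma_{2_+}^Q=2\max_{(\alpha,\beta_1)\in Q}\int_{\beta_1}^{0}\mu(\alpha,\beta)\,d\beta,\qquad \Gamma_{1_-}^Q=2\max_{(\alpha_1,\beta)\in Q}\int_{0}^{\alpha_1}\mu(\alpha,\beta)\,d\alpha.$$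
   Context: Preisach plane: $P=\{(\alpha,\beta)\in\mathbb{R}^2: \alpha\ge\beta\}$, and $P_\gamma=\{(\alpha,\beta)\in P:\alpha\ge 0,\ \beta\le 0\}$. Interfaces: $\mathcal{I}$ is the set of interfaces, i.e. monotonically decreasing staircase lines $L=\{\ell(c): c\in\mathbb{R}_+\}\subset P$ given by a continuous curve $\ell:\mathbb{R}_+\to P$ with $\ell(0)=(b,b)$ for some $b\in\mathbb{R}$ and $\lim_{c\to\infty}\|\ell(c)\|=\infty$. Monotonically decreasing means: for $(\alpha_1,\beta_1),(\alpha_2,\beta_2)\in L$, $\beta_1>\beta_2$ implies $\alpha_1\le\alpha_2$. $\mathcal{I}_\gamma=\{L\in\mathcal{I}:(0,0)\in L\}$; each such $L$ lies in $P_\gamma$. Relays: for $L_0\in\mathcal{I}$ let $r_{\alpha,\beta}(L_0)=1$ if $L_0\cap\{(\alpha_1,\beta_1):\alpha<\alpha_1,\ \beta<\beta_1\}\ne\emptyset$ (the point $(\alpha,\beta)$ is below $L_0$) and $-1$ otherwise. For an absolutely continuous input $u$ with $(u(0),u(0))\in L_0$, the relay $(\mathcal{R}_{\alpha,\beta}(u,L_0))(t)$ equals $1$ if $u(t)>\alpha$, equals $-1$ if $u(t)<\beta$, and if $\beta\le u(t)\le\alpha$ it keeps its previous state $(\mathcal{R}_{\alpha,\beta}(u,L_0))(t_-)$ when $t>0$ and equals $r_{\alpha,\beta}(L_0)$ when $t=0$. (So when $\beta\le u(t)\le\alpha$, the relay has the value it had when $u$ was most recently outside $[\beta,\alpha]$,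 or $r_{\alpha,\beta}(L_0)$ if $u$ has stayed in $[\beta,\alpha]$ on $[0,t]$.) Preisach operator with weighting function $\mu$: $(\mathcal{P}(u,L_0))(t)=\iint_{P}\mu(\alpha,\beta)\,(\mathcal{R}_{\alpha,\beta}(u,L_0))(t)\,d\alpha\,d\beta$. Pulses and remnant: fix $\tau>0$. Let $v_0$ be the unit triangular pulse: $v_0(t)=\frac{2}{\tau}t$ on $[0,\tau/2]$, $v_0(t)=\frac{2}{\tau}(\tau-t)$ on $(\tau/2,\tau]$, and $0$ otherwise. For $w\in\mathbb{R}$ and $I\in\mathcal{I}_\gamma$, the remnant is $\gamma(w,I)=(\mathcal{P}(wv_0,I))(\tau)$. Given $I_0\in\mathcal{I}_\gamma$ and a real sequence $(w_k)_{k\ge 0}$, the input $u_\gamma(t)=\sum_{k\ge0}w_kv_0(t-k\tau)$ is applied starting from $I_0$, and $I_k\in\mathcal{I}_\gamma$ is the interface describing the relay states at time $k\tau$; equivalently, $I_{k+1}\in\mathcal{I}_\gamma$ is the interface such that $r_{\alpha,\beta}(I_{k+1})=(\mathcal{R}_{\alpha,\beta}(w_kv_0,I_k))(\tau)$ for almost every $(\alpha,\beta)\in P$. *)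

(* Defs.v *)
From mathcomp Require Import all_boot all_order all_algebra.
From mathcomp Require Import all_classical all_reals all_analysis.

Set Implicit Arguments.
Unset Strict Implicit.
Unset Printing Implicit Defensive.

Import Order.TTheory GRing.Theory Num.Theory.
Import numFieldNormedType.Exports.

Local Open Scope classical_set_scope.
Local Open Scope ring_scope.

(* Points (alpha, beta) of the plane are pairs: p.1 is alpha, p.2 is beta. *)

Definition preisach_plane (R : realType) : set (R * R) :=
  [set p | p.2 <= p.1].

Definition remnant_plane (R : realType) : set (R * R) :=
  [set p | [/\ preisach_plane p, 0 <= p.1 & p.2 <= 0]].

Definition decreasing_line (R : realType) (L : set (R * R)) : Prop :=
  forall p q : R * R, L p -> L q -> q.2 < p.2 -> p.1 <= q.1.

(* "Staircase" carries no further condition: an interface is any monotonically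
   decreasing line, with axis-parallel steps or not. *)
Definition interface (R : realType) (L : set (R * R)) : Prop :=
  [/\ L `<=` @preisach_plane R,
      exists l : R -> R * R,
        [/\ {within `[0, +oo[, continuous l},
            L = l @` `[0, +oo[,
            exists b : R, l 0 = (b, b) &
            `|l c| @[c --> +oo] --> +oo] &
      decreasing_line L].

Definition interface0 (R : realType) (L : set (R * R)) : Prop :=
  interface L /\ L (0, 0).

Definition relay_init (R : realType) (L : set (R * R)) (p : R * R) : R :=
  if `[< L `&` [set q | p.1 < q.1 /\ p.2 < q.2] !=set0 >] then 1 else - 1.

(* When beta <= u t <= alpha, the relay keeps the value it had when u was most
   recently outside [beta, alpha].  That value is 1 iff u exceeded alpha at some
   time s <= t and has not been below beta since, and it is -1 iff u was below
   beta at some time s <= t and has not exceeded alpha since.  If u has stayed in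
   [beta, alpha] on [0, t], neither holds and the value is the initial state. *)
Definition relay (R : realType) (p : R * R) (u : R -> R) (L : set (R * R))
    (t : R) : R :=
  if p.1 < u t then 1
  else if u t < p.2 then - 1
  else if `[< exists2 s, 0 <= s <= t &
              p.1 < u s /\ forall s', s <= s' <= t -> p.2 <= u s' >] then 1
  else if `[< exists2 s, 0 <= s <= t &
              u s < p.2 /\ forall s', s <= s' <= t -> u s' <= p.1 >] then - 1
  else relay_init L p.

Local Notation lebesgue2 R :=
  (@lebesgue_measure R \x @lebesgue_measure R)%E.

Definition preisach (R : realType) (mu : R * R -> R) (u : R -> R)
    (L : set (R * R)) (t : R) : R :=
  \int[lebesgue2 R]_(p in @preisach_plane R) (mu p * relay p u L t).

Definition pulse (R : realType) (tau t : R) : R :=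
  if 0 <= t <= tau / 2 then 2 / tau * t
  else if tau / 2 < t <= tau then 2 / tau * (tau - t)
  else 0.

Definition remnant (R : realType) (mu : R * R -> R) (tau w : R)
    (L : set (R * R)) : R :=
  preisach mu (fun t => w * pulse tau t) L tau.

(* [I k] is the interface reached after the first k pulses: the relay states left
   at the end of the k-th pulse are the initial states for the next one. *)
Definition interface_sequence (R : realType) (tau : R) (w : nat -> R)
    (I : nat -> set (R * R)) : Prop :=
  forall k : nat, interface0 (I k.+1) /\
    {ae (lebesgue2 R), forall p, preisach_plane p ->
      relay_init (I k.+1) p = relay p (fun t => w k * pulse tau t) (I k) tau}.

(* The weight is only meaningful on the Preisach plane; as this plane is closed,
   the closure in the whole plane is the support. *)
Definition weight_support (R : realType) (mu : R * R -> R) : set (R * R) :=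
  closure [set p | preisach_plane p /\ mu p != 0].

Definition weight_box (R : realType) (mu : R * R -> R) (alpha2 beta2 : R) :
    set (R * R) :=
  weight_support mu `&` @remnant_plane R `&`
    [set p | 0 <= p.1 <= alpha2 /\ beta2 <= p.2 <= 0].

Definition column_integral (R : realType) (mu : R * R -> R) (p : R * R) : R :=
  \int[@lebesgue_measure R]_(b in `[p.2, 0]) mu (p.1, b).

Definition row_integral (R : realType) (mu : R * R -> R) (p : R * R) : R :=
  \int[@lebesgue_measure R]_(a in `[0, p.1]) mu (a, p.2).

Definition is_max (R : realType) (S : set R) (m : R) : Prop :=
  S m /\ ubound S m.

(* Main.v *)
(* A pulse of amplitude w erases the memory of every relay of the quadrant
   alpha >= 0 >= beta with alpha < w (set to 1) or w < beta (set to -1) and leaves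
   the other relays of the quadrant untouched.  Since all amplitudes lie in
   [beta2, alpha2], the relays with alpha < alpha2 and beta < beta2 remain in
   state 1, and those with alpha > alpha2 and beta > beta2 in state -1: this holds
   for I 0 and is preserved by pulses.  Hence increasing the amplitude from x to
   y only switches relays from -1 to 1 in the vertical strip x <= alpha < y of
   the box [0, alpha2] x [beta2, 0], where mu is nonnegative, and by Tonelli the
   remnant grows by at most 2 (y - x) times the largest column integral.
   Decreasing the amplitude acts likewise on a horizontal strip. *)

Require Import Defs.
From mathcomp Require Import all_boot all_order all_algebra.
From mathcomp Require Import all_classical all_reals all_analysis.
From mathcomp Require Import measurable_realfun lra.

Set Implicit Arguments.
Unset Strict Implicit.
Unset Printing Implicit Defensive.

Import Order.TTheory GRing.Theory Num.Theory.
Import numFieldNormedType.Exports.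

Local Open Scope classical_set_scope.
Local Open Scope ring_scope.

Local Notation lebesgue2 R :=
  (@lebesgue_measure R \x @lebesgue_measure R)%E.

(** * Topology and measurability in the plane *)

(** An open set is the union of the boxes with rational centres and radii that it contains, a
    countable family in the product sigma-algebra. *)
Lemma open_measurable_prod (R : realType) (A : set (R * R)) :
  open A -> measurable A.
Proof.
move=> oA.
pose box (q : rat * rat * rat * rat) : set (R * R) :=
  ball (ratr q.1.1.1 : R) (ratr q.1.1.2) `*` ball (ratr q.1.2 : R) (ratr q.2).
have -> : A = \bigcup_(q in [set q | box q `<=` A]) box q.
  apply/seteqP; split => [[x y] Axy|p [q /= qA qp]]; last exact: qA.
  have /= : nbhs (x, y) A by move: oA; rewrite openE; exact.
  case=> -[U V] /= [/nbhs_interior Ux /nbhs_interior Vy] UVA.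
  have [c [r [xcr crU]]] := open_subball_rat (@open_interior _ U)
    (mem_set (nbhs_singleton Ux)).
  have [c' [r' [ycr crV]]] := open_subball_rat (@open_interior _ V)
    (mem_set (nbhs_singleton Vy)).
  exists (c, r, c', r'); last by split => /=; apply/set_mem.
  move=> [a b] [/= /crU/interior_subset Ua /crV/interior_subset Vb].
  by apply: UVA.
rewrite bigcup_mkcond; apply: countable_bigcupT_measurable => // q.
case: ifPn => // _.
by apply: measurableX; apply: open_measurable; exact: ball_open.
Qed.

Lemma continuous_measurable_prod (R : realType) (f : R * R -> R) :
  continuous f -> measurable_fun setT f.
Proof.
move=> /continuousP cf _.
apply: (measurability _ (RGenOpens.measurableE R)) => //.
move=> _ [_ [a [b ->] <-]]; rewrite setTI; apply: open_measurable_prod.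
exact/cf/interval_open.
Qed.

(** A maximizer of the continuous majorant [G] can be moved, without changing [G], to a point where
    [C] meets [G]; so [C] has a maximum, and it bounds [G] as well. *)
Lemma compact_continuous_max (T : topologicalType) (R : realType) (K : set T)
    (C G : T -> R) : K !=set0 -> compact K -> continuous G ->
  (forall p, K p -> C p <= G p) ->
  (forall p, K p -> exists2 q, K q & C q = G q /\ G q = G p) ->
  exists M, is_max (C @` K) M /\ forall p, K p -> G p <= M.
Proof.
move=> K0 cK cG CG KK.
have [p /set_mem Kp pmax] := compact_EVT_max K0 cK (continuous_subspaceT cG).
have [q Kq [CGq Gqp]] := KK _ Kp.
have GC r : K r -> G r <= C q.
  by move=> Kr; rewrite CGq Gqp; apply: pmax; exact: mem_set.
exists (C q); split => //; split; first by exists q.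
by move=> _ [r Kr <-]; apply: (le_trans (CG _ Kr)); exact: GC.
Qed.

Lemma within_continuous_comp_total (T U V : topologicalType) (A : set U)
    (f : U -> V) (g : T -> U) :
  {within A, continuous f} -> continuous g -> (forall x, A (g x)) ->
  continuous (f \o g).
Proof.
move=> /subspace_continuousP cf cg Ag x.
apply: (@cvg_comp _ _ _ g f _ (within A (nbhs (g x)))); last exact: cf.
move=> W /cg AW.
by apply: (@filterS _ (nbhs x) _ _ (g @^-1` W) _ AW) => y /(_ (Ag y)).
Qed.

(** * The half-plane and the support of the weight *)

Lemma preisach_plane_closed (R : realType) : closed (@preisach_plane R).
Proof.
have -> : @preisach_plane R = (fun p : R * R => p.1 - p.2) @^-1` `[0, +oo[.
  by apply/seteqP; split=> p; rewrite /preisach_plane /= in_itv/= andbT subr_ge0.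
apply: (preimage_closed (f := fun p : R * R => p.1 - p.2)); last exact: interval_closed.
by move=> p _; apply: cvgB; [exact: cvg_fst|exact: cvg_snd].
Qed.

Lemma weight_support_eq0 (R : realType) (mu : R * R -> R) (p : R * R) :
  preisach_plane p -> ~ weight_support mu p -> mu p = 0.
Proof.
move=> Pp; apply: contra_notP => /eqP mup.
by rewrite /weight_support; apply: subset_closure => /=; split.
Qed.

Lemma weight_support_preisach (R : realType) (mu : R * R -> R) :
  weight_support mu `<=` @preisach_plane R.
Proof.
rewrite /weight_support.
rewrite [X in _ `<=` X](closure_id _).1; last exact: preisach_plane_closed.
by apply: closureS => p [].
Qed.

(** Precomposition with the retraction [(a, b) |-> (max a b, b)] onto the half-plane. Global
    continuity is what later gives measurability of the weight. *)
Lemma preisach_extension (R : realType) (mu : R * R -> R) :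
  {within @preisach_plane R, continuous mu} ->
  exists2 nu : R * R -> R, continuous nu &
    forall p, preisach_plane p -> nu p = mu p.
Proof.
move=> cmu; exists (mu \o fun p : R * R => (Num.max p.1 p.2, p.2)).
  apply: within_continuous_comp_total cmu _ _.
    move=> p; apply: (@cvg_pair _ _ _ _ (nbhs (_ : R)) (nbhs (_ : R)));
      last exact: cvg_snd.
    by apply: (@continuous_max R (R * R)%type fst snd p); [exact: cvg_fst|exact: cvg_snd].
  by move=> p; rewrite /preisach_plane /= le_max lexx orbT.
by case=> a b; rewrite /preisach_plane /= => ba; rewrite max_l.
Qed.

Lemma weight_bounded (R : realType) (mu : R * R -> R) :
  {within @preisach_plane R, continuous mu} -> compact (weight_support mu) ->
  exists B, forall p, preisach_plane p -> `|mu p| <= B.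
Proof.
move=> cmu cS.
have /compact_bounded/ex_strict_bound_gt0[B B0 Bmu] :
    compact (mu @` weight_support mu).
  apply: continuous_compact => //.
  exact: continuous_subspaceW (@weight_support_preisach _ mu) cmu.
exists B => // p Pp; have [Sp|Sp] := pselect (weight_support mu p).
  by apply: ltW; apply: Bmu; exists p.
by rewrite weight_support_eq0// normr0 ltW.
Qed.

Lemma preisach_plane_measurable (R : realType) : measurable (@preisach_plane R).
Proof.
rewrite -[X in measurable X]setCK; apply: measurableC; apply: open_measurable_prod.
by apply: closed_openC; exact: preisach_plane_closed.
Qed.

(** * Slices, parametric integrals and integrals over strips *)

Lemma continuous_slicel (R : realType) (f : R * R -> R) (x : R) :
  continuous f -> continuous (fun y => f (x, y)).
Proof.
move=> cf y; apply: (@continuous_comp _ _ _ (pair x) f); last exact: cf.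
by apply: (@cvg_pair _ _ _ _ (nbhs (_ : R)) (nbhs (_ : R)));
  [exact: cvg_cst|exact: cvg_id].
Qed.

Lemma continuous_slicer (R : realType) (f : R * R -> R) (y : R) :
  continuous f -> continuous (fun x => f (x, y)).
Proof.
move=> cf x; apply: (@continuous_comp _ _ _ (pair^~ y) f); last exact: cf.
by apply: (@cvg_pair _ _ _ _ (nbhs (_ : R)) (nbhs (_ : R)));
  [exact: cvg_id|exact: cvg_cst].
Qed.

Lemma continuous_swap (R : realType) (f : R * R -> R) :
  continuous f -> continuous (fun p => f (p.2, p.1)).
Proof.
move=> cf p; apply: (@continuous_comp _ _ _ (fun q : R * R => (q.2, q.1)) f);
  last exact: cf.
by apply: (@cvg_pair _ _ _ _ (nbhs (_ : R)) (nbhs (_ : R)));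
  [exact: cvg_snd|exact: cvg_fst].
Qed.

Lemma continuous_segment_integrable (R : realType) (f : R -> R) (c d : R) :
  continuous f -> (@lebesgue_measure R).-integrable `[c, d] (EFin \o f).
Proof.
move=> cf; apply: continuous_compact_integrable; first exact: segment_compact.
exact: continuous_subspaceT.
Qed.

(** Dominated convergence near [a], with the constant [B] as majorant on the segment. *)
Lemma parametric_integral_continuous (R : realType) (f : R * R -> R) (B c d : R) :
  continuous f -> (forall p, `|f p| <= B) ->
  continuous (fun a => \int[@lebesgue_measure R]_(b in `[c, d]) f (a, b)).
Proof.
move=> cf fB a.
apply: (@continuity_under_integral R _ _ (@lebesgue_measure R)
  (fun a b => f (a, b)) `[c, d] _ (a - 1) (a + 1) _ _ (cst B)).
- by [].
- by move=> x _; apply: continuous_segment_integrable; exact: continuous_slicel.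
- by apply: aeW => y _ x _; exact: continuous_slicer.
- by apply: continuous_segment_integrable => ?; exact: cvg_cst.
- by move=> x _; apply: aeW.
- by rewrite inE /= in_itv /=; apply/andP; split; lra.
Qed.

(** Tonelli with the columns integrated first: the inner integral is at most [M] over [A] and zero
    elsewhere. *)
Lemma column_strip_integral_le (R : realType) (f : R * R -> R) (A : set R)
    (c d M : R) : measurable A -> continuous f -> (forall p, 0 <= f p) ->
  (forall a, \int[@lebesgue_measure R]_(b in `[c, d]) f (a, b) <= M) ->
  (\int[lebesgue2 R]_(p in A `*` `[c, d]) (f p)%:E <=
    M%:E * @lebesgue_measure R A)%E.
Proof.
move=> mA cf f0 fM.
have mf : measurable_fun setT (EFin \o f).
  by apply/measurable_EFinP; exact: continuous_measurable_prod.
have mAC : measurable (A `*` `[c, d]%classic) by apply: measurableX.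
rewrite integral_mkcond; set g := (X in integral _ _ X).
have g0 p : (0 <= g p)%E by rewrite /g patchE; case: ifP; rewrite // lee_fin.
have mg : measurable_fun setT g.
  by apply/(measurable_restrictT _ _).1 => //; exact: measurable_funS mf.
have M0 : 0 <= M by apply: le_trans (fM 0); apply: Rintegral_ge0.
rewrite fubini_tonelli1 // -integral_cst // [leRHS]integral_mkcond.
apply: ge0_le_integral => //.
- by move=> x _; apply: integral_ge0 => y _; exact: g0.
- exact: measurable_fun_fubini_tonelli_F.
- by apply/(measurable_restrictT _ _).1.
move=> x _; rewrite /fubini_F [leRHS]patchE; case: ifPn => xA.
  rewrite -[leRHS]/(M%:E).
  rewrite (_ : (fun y => g (x, y)) = (fun y => (f (x, y))%:E) \_ `[c, d]); last first.
    by apply/funext => y; rewrite /g !patchE in_setX /= xA.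
  rewrite -integral_mkcond -[leLHS]fineK ?lee_fin; first exact: fM.
  apply: integrable_fin_num => //; apply: continuous_segment_integrable.
  exact: continuous_slicel.
by rewrite integral0_eq// => y _; rewrite /g patchE in_setX /= (negbTE xA).
Qed.

(** Tonelli in the other order, with the rows integrated first. *)
Lemma row_strip_integral_le (R : realType) (f : R * R -> R) (A : set R)
    (c d M : R) : measurable A -> continuous f -> (forall p, 0 <= f p) ->
  (forall a, \int[@lebesgue_measure R]_(b in `[c, d]) f (b, a) <= M) ->
  (\int[lebesgue2 R]_(p in `[c, d] `*` A) (f p)%:E <=
    M%:E * @lebesgue_measure R A)%E.
Proof.
move=> mA cf f0 fM.
have mf : measurable_fun setT (EFin \o f).
  by apply/measurable_EFinP; exact: continuous_measurable_prod.
have mAC : measurable (`[c, d]%classic `*` A) by apply: measurableX.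
rewrite integral_mkcond; set g := (X in integral _ _ X).
have g0 p : (0 <= g p)%E by rewrite /g patchE; case: ifP; rewrite // lee_fin.
have mg : measurable_fun setT g.
  by apply/(measurable_restrictT _ _).1 => //; exact: measurable_funS mf.
have M0 : 0 <= M by apply: le_trans (fM 0); apply: Rintegral_ge0.
rewrite fubini_tonelli2 // -integral_cst // [leRHS]integral_mkcond.
apply: ge0_le_integral => //.
- by move=> x _; apply: integral_ge0 => y _; exact: g0.
- exact: measurable_fun_fubini_tonelli_G.
- by apply/(measurable_restrictT _ _).1.
move=> x _; rewrite /fubini_G [leRHS]patchE; case: ifPn => xA.
  rewrite -[leRHS]/(M%:E).
  rewrite (_ : (fun y => g (y, x)) = (fun y => (f (y, x))%:E) \_ `[c, d]); last first.
    by apply/funext => y; rewrite /g !patchE in_setX /= xA andbT.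
  rewrite -integral_mkcond -[leLHS]fineK ?lee_fin; first exact: fM.
  apply: integrable_fin_num => //; apply: continuous_segment_integrable.
  exact: continuous_slicer.
by rewrite integral0_eq// => y _; rewrite /g patchE in_setX /= (negbTE xA) andbF.
Qed.

(** * Effect of one pulse on one relay *)

Lemma pulse_bound (R : realType) (tau t : R) : 0 < tau -> 0 <= pulse tau t <= 1.
Proof.
move=> tau0; have ti : 0 < tau^-1 by rewrite invr_gt0.
have tt : tau^-1 * tau = 1 by rewrite mulVf// gt_eqF.
rewrite /pulse; case: ifP => [/andP[? ?]|_]; last case: ifP => [/andP[? ?]|_].
- by apply/andP; split; nra.
- by apply/andP; split; nra.
- by rewrite lexx ler01.
Qed.

Lemma pulse_half (R : realType) (tau : R) : 0 < tau -> pulse tau (tau / 2) = 1.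
Proof.
move=> tau0; rewrite /pulse lexx andbT divr_ge0 ?ltW//.
by rewrite mulrA divfK ?mulfV ?gt_eqF.
Qed.

Lemma pulse_end (R : realType) (tau : R) : 0 < tau -> pulse tau tau = 0.
Proof.
move=> tau0; rewrite /pulse subrr mulr0; case: ifP => [/andP[? ?]|_]; first lra.
by case: ifP.
Qed.

(** The state in which a pulse of amplitude [w] leaves relay [p] when started from state [r]. The
    two tests against 0 take precedence because the input is back at 0 when the pulse ends. *)
Definition pulse_state (R : realType) (w : R) (p : R * R) (r : R) : R :=
  if p.1 < 0 then 1 else if 0 < p.2 then - 1 else
  if p.1 < w then 1 else if w < p.2 then - 1 else r.

Lemma relay_pulse (R : realType) (tau w : R) (L : set (R * R)) (p : R * R) :
  0 < tau ->
  relay p (fun t => w * pulse tau t) L tau = pulse_state w p (relay_init L p).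
Proof.
move=> tau0; rewrite /pulse_state /relay pulse_end// mulr0.
have [//|p1] := ltP p.1 0; have [//|p2] := ltP 0 p.2.
have pb t := pulse_bound t tau0.
have half : 0 <= tau / 2 <= tau by apply/andP; split; lra.
have [pw|wp] := ltP p.1 w.
  (* At the peak the input is [w > p.1 >= 0]; such a pulse is nonnegative throughout, so it never
     falls below [p.2 <= 0]. *)
  case: asboolP => // -[]; exists (tau / 2) => //; rewrite pulse_half// mulr1.
  split => // t _; have /andP[] := pb t; nra.
(* The input stays between 0 and [w], both at most [p.1], so the relay is never switched up. *)
case: asboolP => [[s _ [ps _]]|_].
  by have /andP[] := pb s; nra.
have [wp2|pw2] := ltP w p.2.
  case: asboolP => // -[]; exists (tau / 2) => //; rewrite pulse_half// mulr1.
  by split => // t _; have /andP[] := pb t; nra.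
case: asboolP => [[s _ [ps _]]|//].
by have /andP[] := pb s; nra.
Qed.

(** The points below [L] form a union of open quadrants, one for each point of [L]; the union may be
    uncountable, but it is open. *)
Lemma relay_init_measurable (R : realType) (L : set (R * R)) :
  measurable_fun setT (relay_init L).
Proof.
rewrite /relay_init; apply: measurable_fun_ifT => //.
set S := (X in measurable_fun _ X).
apply: (measurable_fun_bool true); rewrite setTI.
rewrite (_ : _ @^-1` _ = \bigcup_(q in L) [set p | p.1 < q.1 /\ p.2 < q.2]); last first.
  apply/seteqP; split => [p /asboolP[q [Lq /= pq]]|p [q Lq pq]]; first by exists q.
  by apply/asboolP; exists q.
apply: open_measurable_prod; apply: bigcup_open => q _.
apply: openI.
  apply: (@open_comp _ _ fst [set x | x < q.1]); last exact: open_lt.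
  by move=> ? _; exact: cvg_fst.
apply: (@open_comp _ _ snd [set x | x < q.2]); last exact: open_lt.
by move=> ? _; exact: cvg_snd.
Qed.

Lemma relay_pulse_measurable (R : realType) (tau w : R) (L : set (R * R)) :
  0 < tau ->
  measurable_fun setT (fun p => relay p (fun t => w * pulse tau t) L tau).
Proof.
move=> tau0.
under eq_fun do rewrite relay_pulse // /pulse_state.
do 4 ! (apply: measurable_fun_ifT => //; first exact: measurable_fun_ltr).
exact: relay_init_measurable.
Qed.

Lemma relay_norm_le1 (R : realType) (p : R * R) (u : R -> R) (L : set (R * R)) (t : R) :
  `|relay p u L t| <= 1.
Proof. by rewrite /relay /relay_init; do ! case: ifP => _; rewrite ?normrN normr1. Qed.

(** * Position of an interface relative to the box *)

(** In the half-plane, [q.1 < 0] forces [q.2 < 0], which puts [q] strictly below and to the left of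
    the origin, against monotonicity. The case [q.2 > 0] is symmetric. *)
Lemma interface0_quadrant (R : realType) (L : set (R * R)) (q : R * R) :
  interface0 L -> L q -> 0 <= q.1 /\ q.2 <= 0.
Proof.
move=> [[LP _ decL] L0] Lq; have := LP _ Lq; rewrite /preisach_plane/= => Pq.
have := decL _ _ Lq L0; have := decL _ _ L0 Lq => /= H1 H2.
split; rewrite leNgt; apply/negP => h.
  by have := H1 (le_lt_trans Pq h); lra.
by have := H2 h; lra.
Qed.

(** On the quadrant the maximum is the gauge of the box [[0, a] x [b, 0]]. Along the curve it is
    continuous, starts at 0 (a diagonal point of the quadrant is the origin) and is unbounded, so it
    takes every level. *)
Lemma interface0_level (R : realType) (L : set (R * R)) (a b v : R) :
  interface0 L -> 0 < a -> b < 0 -> 0 <= v ->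
  exists2 q, L q & Num.max (q.1 / a) (q.2 / b) = v.
Proof.
move=> IL a0 b0 v0; have [[LP [l [cl Ll [b1 l0] loo]] decL] L0] := IL.
have Lin c : 0 <= c -> L (l c).
  by move=> c0; rewrite Ll; exists c => //=; rewrite in_itv /= c0.
(* Since [a - b] exceeds both [a] and [- b], a sup norm of at least [v * (a - b)] forces one of the
   two quotients to reach [v]. *)
have [c [c0 lc]] : exists c, 0 <= c /\ v * (a - b) <= `|l c|.
  near (pinfty_nbhs R) => c; exists c; split; first by near: c; exact: nbhs_pinfty_ge.
  by near: c; move/cvgryPge : loo; exact.
pose h t := Num.max ((l t).1 / a) ((l t).2 / b).
have ch : {within `[0, c], continuous h}.
  have cl0 : {within `[0, c], continuous l}.
    by apply: continuous_subspaceW cl; apply: subset_itvl.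
  have c1 : {within `[0, c], continuous (fun t => (l t).1 / a)}.
    move=> x; apply: cvgM; last exact: cvg_cst.
    by apply: (cvg_comp _ _ (cl0 x)); exact: cvg_fst.
  have c2 : {within `[0, c], continuous (fun t => (l t).2 / b)}.
    move=> x; apply: cvgM; last exact: cvg_cst.
    by apply: (cvg_comp _ _ (cl0 x)); exact: cvg_snd.
  by move=> x; apply: (continuous_max (c1 x) (c2 x)).
have h0 : h 0 = 0.
  have := interface0_quadrant IL (Lin _ (lexx 0)); rewrite /h l0 /= => -[b1p b1n].
  by rewrite (_ : b1 = 0) ?mul0r ?maxxx//; lra.
have hc : v <= h c.
  have [lp ln] := interface0_quadrant IL (Lin _ c0).
  move: lc; rewrite prod_normE /h (ger0_norm lp) (ler0_norm ln) le_max.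
  rewrite le_max ler_pdivlMr// ler_ndivlMr//.
  by case/orP => ?; apply/orP; [left|right]; nra.
have [|t] := IVT c0 ch (v := v).
  by rewrite h0 ge_min v0 /= le_max hc orbT.
rewrite in_itv /= => /andP[t0 _] ht; exists (l t); first exact: Lin.
exact: ht.
Unshelve. all: end_near. Qed.

(* Just outside the box [0, a] x [b, 0] the line has a point on the boundary of
   the box scaled by 1 + eps; there one coordinate is beyond the box, so the
   hypothesis forces the other one to be beyond it too. *)
Lemma interface0_below_corner (R : realType) (L : set (R * R)) (a b : R)
    (p : R * R) :
  interface0 L -> 0 < a -> b < 0 ->
  (forall q, L q -> (q.2 < b -> a <= q.1) /\ (a < q.1 -> q.2 <= b)) ->
  p.1 < a -> p.2 < b -> relay_init L p = 1.
Proof.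
move=> IL a0 b0 Lbox pa pb; rewrite /relay_init; case: asboolP => // -[].
(* Halfway between 1 and [p.2 / b]: above 1 the point [q] is outside the box, and below [p.2 / b] it
   satisfies [p.2 < q.2]. *)
pose e := (1 + p.2 / b) / 2.
have pb1 : 1 < p.2 / b by rewrite ltr_ndivlMr// mul1r.
have [q Lq qv] := @interface0_level _ _ _ _ e IL a0 b0 ltac:(by rewrite /e; lra).
have [qa qb] := Lbox _ Lq.
have qe1 : q.1 / a <= e by rewrite -qv le_max lexx.
have qe2 : q.2 / b <= e by rewrite -qv le_max lexx orbT.
have e1 : 1 < e by rewrite /e; lra.
have p2q : p.2 < q.2.
  have : q.2 / b < p.2 / b by rewrite /e in qe2; lra.
  by rewrite ltr_nM2r// invr_lt0.
exists q; split => //; split => //.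
(* If [q.2 >= b], the second quotient is at most 1, so the level [e > 1] is reached by the first one
   and [q.1 > a]. *)
have [/qa|bq] := ltP q.2 b; first exact: lt_le_trans.
have qb1 : q.2 / b <= 1 by rewrite ler_ndivrMr// mul1r.
have : e <= q.1 / a by move: qv; rewrite maxEle; case: ifP => _ h; lra.
by rewrite ler_pdivlMr//; nra.
Qed.

Lemma interface0_above_corner (R : realType) (L : set (R * R)) (a b : R)
    (p : R * R) :
  (forall q, L q -> (q.2 < b -> a <= q.1) /\ (a < q.1 -> q.2 <= b)) ->
  a < p.1 -> b < p.2 -> relay_init L p = - 1.
Proof.
move=> Lbox pa pb; rewrite /relay_init; case: asboolP => // -[q [Lq /= [q1 q2]]].
by have [_ /(_ (lt_trans pa q1))] := Lbox _ Lq; lra.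
Qed.

(** * Maxima of the column and row integrals over the box part of the support *)

Lemma segment_integral_subset (R : realType) (f : R -> R) (c d c' d' : R) :
  continuous f -> (forall x, 0 <= f x) -> c' <= c -> d <= d' ->
  \int[@lebesgue_measure R]_(x in `[c, d]) f x <=
    \int[@lebesgue_measure R]_(x in `[c', d']) f x.
Proof.
move=> cf f0 cc dd; apply: fine_le.
- by apply: integrable_fin_num => //; exact: continuous_segment_integrable.
- by apply: integrable_fin_num => //; exact: continuous_segment_integrable.
apply: ge0_subset_integral => //.
- apply/measurable_EFinP; apply: measurable_funTS.
  exact: continuous_measurable_fun.
- by move=> x _; rewrite lee_fin.
- by apply: subset_itv; rewrite bnd_simp.
Qed.

Lemma segment_integral_eq (R : realType) (f : R -> R) (c d c' d' : R) :
  c' <= c -> d <= d' ->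
  (forall x, c' <= x <= d' -> x < c \/ d < x -> f x = 0) ->
  \int[@lebesgue_measure R]_(x in `[c, d]) f x =
    \int[@lebesgue_measure R]_(x in `[c', d']) f x.
Proof.
move=> cc dd f0; rewrite Rintegral_mkcond [RHS]Rintegral_mkcond.
apply: eq_Rintegral => x _; rewrite !patchE !mem_setE !in_itv /=.
case: ifPn => [/andP[cx xd]|xcd]; case: ifPn => [xcd'|] //.
- by rewrite (le_trans cc cx) (le_trans xd dd).
- rewrite f0 //; move: xcd; rewrite negb_and -!ltNge => /orP[]; by [left|right].
Qed.

Lemma weight_box_compact (R : realType) (mu : R * R -> R) (a b : R) :
  compact (weight_support mu) -> compact (weight_box mu a b).
Proof.
move=> cS; apply: (subclosed_compact _ cS); last by move=> p [[]].
have -> : weight_box mu a b = weight_support mu `&`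
    (fst @^-1` `[0, a]%classic `&` snd @^-1` `[b, 0]%classic).
  apply/seteqP; split => [p [[Sp [Pp p1 p2]] [pa pb]]|p [Sp []]].
    by split => //; split; rewrite /= in_itv.
  rewrite /= !in_itv /= => pa pb; split => //; split => //; split.
  - exact: weight_support_preisach Sp.
  - by case/andP: pa.
  - by case/andP: pb.
apply: closedI; first exact: closed_closure.
apply: closedI; apply: preimage_closed; try exact: interval_closed.
  by move=> p _; exact: cvg_fst.
by move=> p _; exact: cvg_snd.
Qed.

(* The composition with the nearest-point projection onto the box: continuous
   on the whole plane even though [mu] is only continuous on the half-plane. *)
Definition box_extension (R : realType) (mu : R * R -> R) (a b : R) (p : R * R) : R :=
  mu (Num.max 0 (Num.min p.1 a), Num.min 0 (Num.max p.2 b)).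

Section BoxExtension.
Variables (R : realType) (mu : R * R -> R) (a b : R).
Hypotheses (a0 : 0 < a) (b0 : b < 0).
Hypothesis mu_cont : {within @preisach_plane R, continuous mu}.
Hypothesis mu_supp : compact (weight_support mu).
Hypothesis mu_ge0 : forall p, weight_box mu a b p -> 0 <= mu p.

Local Notation m := (box_extension mu a b).
Local Notation Q := (weight_box mu a b).

Lemma clampl_bound x : 0 <= Num.max 0 (Num.min x a) <= a.
Proof. by rewrite le_max lexx /= ge_max ltW// ge_min lexx orbT. Qed.

Lemma clampr_bound x : b <= Num.min 0 (Num.max x b) <= 0.
Proof. by rewrite ge_min lexx andbT le_min ltW//= le_max lexx orbT. Qed.

Lemma box_extension_continuous : continuous m.
Proof.
apply: (within_continuous_comp_total (g := fun p : R * R =>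
  (Num.max 0 (Num.min p.1 a), Num.min 0 (Num.max p.2 b))) mu_cont).
  move=> p; apply: (@cvg_pair _ _ _ _ (nbhs (_ : R)) (nbhs (_ : R))).
    apply: (@continuous_max R _ (cst 0) (fun p : R * R => Num.min p.1 a));
      first exact: cvg_cst.
    by apply: (@continuous_min R _ fst (cst a)); [exact: cvg_fst|exact: cvg_cst].
  apply: (@continuous_min R _ (cst 0) (fun p : R * R => Num.max p.2 b));
    first exact: cvg_cst.
  by apply: (@continuous_max R _ snd (cst b)); [exact: cvg_snd|exact: cvg_cst].
move=> p; have /andP[+ _] := clampl_bound p.1; have /andP[_ +] := clampr_bound p.2.
exact: le_trans.
Qed.

Lemma box_extensionE p : 0 <= p.1 <= a -> b <= p.2 <= 0 -> m p = mu p.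
Proof.
case: p => x y /= /andP[x0 xa] /andP[yb y0]; rewrite /box_extension /=.
by rewrite (min_l xa) (max_r x0) (max_l yb) (min_r y0).
Qed.

Lemma box_weight_eq0 p : 0 <= p.1 <= a -> b <= p.2 <= 0 -> ~ Q p -> mu p = 0.
Proof.
move=> pa pb nQ; have Pp : preisach_plane p.
  by case/andP: pa => + _; case/andP: pb => _; exact: le_trans.
apply: weight_support_eq0 => // Sp; apply: nQ; split => //; split => //; split => //.
  by case/andP: pa.
by case/andP: pb.
Qed.

(** The projected point is either in [Q], where the weight is nonnegative, or outside the support,
    where it vanishes. *)
Lemma box_extension_ge0 p : 0 <= m p.
Proof.
rewrite /box_extension; set q := (_, _).
have qa : 0 <= q.1 <= a := clampl_bound _.
have qb : b <= q.2 <= 0 := clampr_bound _.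
by have [/mu_ge0//|nQ] := pselect (Q q); rewrite box_weight_eq0.
Qed.

Lemma box_extension_bounded : exists B, forall p, `|m p| <= B.
Proof.
have [B Bmu] := weight_bounded mu_cont mu_supp; exists B => p; apply: Bmu.
have /andP[+ _] := clampl_bound p.1; have /andP[_ +] := clampr_bound p.2.
exact: le_trans.
Qed.

Lemma box_extension_clampl x y : m (Num.max 0 (Num.min x a), y) = m (x, y).
Proof.
have /andP[x0 xa] := clampl_bound x.
by rewrite /box_extension /= (min_l xa) (max_r x0).
Qed.

Lemma box_extension_clampr x y : m (x, Num.min 0 (Num.max y b)) = m (x, y).
Proof.
have /andP[yb y0] := clampr_bound y.
by rewrite /box_extension /= (max_l yb) (min_r y0).
Qed.

Hypothesis Q_neq0 : Q !=set0.

(* The lowest point of Q in a column attains the integral over the whole height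
   of the box, so the maximum over Q is that of a continuous function. *)
Lemma column_integral_max : exists M, is_max (column_integral mu @` Q) M /\
  forall x, \int[@lebesgue_measure R]_(y in `[b, 0]) m (x, y) <= M.
Proof.
have [B mB] := box_extension_bounded.
have cm := box_extension_continuous.
pose G (p : R * R) := \int[@lebesgue_measure R]_(y in `[b, 0]) m (p.1, y).
have CE p : Q p -> column_integral mu p =
    \int[@lebesgue_measure R]_(y in `[p.2, 0]) m (p.1, y).
  move=> [_ [/= pa /andP[pb _]]]; apply: eq_Rintegral => y.
  rewrite inE /= in_itv /= => /andP[py y0]; rewrite box_extensionE //=.
  by rewrite (le_trans pb py).
have [M [MC MG]] : exists M, is_max (column_integral mu @` Q) M /\
    forall p, Q p -> G p <= M.
  apply: compact_continuous_max => //.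
  - exact: weight_box_compact.
  - move=> p; apply: (@continuous_comp _ _ _ fst
      (fun x => \int[@lebesgue_measure R]_(y in `[b, 0]) m (x, y))).
      exact: cvg_fst.
    exact: parametric_integral_continuous mB _.
  - move=> p Qp; rewrite CE //; have [_ [_ /andP[pb _]]] := Qp.
    apply: segment_integral_subset => //; first exact: continuous_slicel.
    by move=> ?; exact: box_extension_ge0.
  move=> p Qp; pose K := Q `&` fst @^-1` [set p.1].
  have cK : compact K.
    apply: (subclosed_compact _ (weight_box_compact (b:=b) (a:=a) mu_supp));
      last by move=> ? [].
    apply: closedI.
      by apply: compact_closed; [exact: norm_hausdorff|exact: weight_box_compact].
    by apply: preimage_closed; [move=> ? _; exact: cvg_fst|exact: closed_eq].
  have [||q /set_mem[Qq /= qp] qmin] := @compact_EVT_min _ _ snd K _ cK.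
  - by exists p.
  - by apply: continuous_subspaceT => ?; exact: cvg_snd.
  exists q => //; split; last by rewrite /G qp.
  rewrite CE // /G; have [_ [qa /andP[qb q0]]] := Qq.
  (* Below [q], the lowest point of its column, the column misses [Q], so the weight vanishes
     there. *)
  apply: segment_integral_eq => // y yb [yq|]; last first.
    by case/andP: yb => _ y0; rewrite ltNge y0.
  rewrite box_extensionE // box_weight_eq0 // => Qy.
  suff : q.2 <= y by rewrite leNgt yq.
  by apply: (qmin (q.1, y)); rewrite inE.
exists M; split => // x; set x' := Num.max 0 (Num.min x a).
have -> : \int[@lebesgue_measure R]_(y in `[b, 0]) m (x, y) = G (x', 0).
  by apply: eq_Rintegral => y _; rewrite box_extension_clampl.
(* Any column has the integral of its clamped column [x']. If that column misses [Q] the integral is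
   0, and [M] is nonnegative because [Q] has a point. *)
have [[y Qy]|nQ] := pselect (exists y, Q (x', y)); first exact: (MG _ Qy).
have [p Qp] := Q_neq0; apply: le_trans (MG _ Qp).
rewrite /G [leLHS](_ : _ = 0).
  by apply: Rintegral_ge0 => y _; exact: box_extension_ge0.
rewrite /Rintegral integral0_eq //= => y; rewrite in_itv /= => yb.
rewrite box_extensionE ?box_weight_eq0 //=; try exact: clampl_bound.
by move=> Qy; apply: nQ; exists y.
Qed.

(** The rightmost point of [Q] in a row now plays the part of the lowest point in a column. *)
Lemma row_integral_max : exists M, is_max (row_integral mu @` Q) M /\
  forall x, \int[@lebesgue_measure R]_(y in `[0, a]) m (y, x) <= M.
Proof.
have [B mB] := box_extension_bounded.
have cm := box_extension_continuous.
pose G (p : R * R) := \int[@lebesgue_measure R]_(y in `[0, a]) m (y, p.2).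
have CE p : Q p -> row_integral mu p =
    \int[@lebesgue_measure R]_(y in `[0, p.1]) m (y, p.2).
  move=> [_ [/= /andP[_ pa] pb]]; apply: eq_Rintegral => y.
  rewrite inE /= in_itv /= => /andP[y0 yp]; rewrite box_extensionE //=.
  by rewrite y0 (le_trans yp pa).
have [M [MC MG]] : exists M, is_max (row_integral mu @` Q) M /\
    forall p, Q p -> G p <= M.
  apply: compact_continuous_max => //.
  - exact: weight_box_compact.
  - move=> p; apply: (@continuous_comp _ _ _ snd
      (fun x => \int[@lebesgue_measure R]_(y in `[0, a]) m (y, x))).
      exact: cvg_snd.
    apply: (@parametric_integral_continuous R (fun p => m (p.2, p.1)) B 0 a).
      exact: continuous_swap.
    by move=> ?; exact: mB.
  - move=> p Qp; rewrite CE //; have [_ [/andP[_ pa] _]] := Qp.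
    apply: segment_integral_subset => //; first exact: continuous_slicer.
    by move=> ?; exact: box_extension_ge0.
  move=> p Qp; pose K := Q `&` snd @^-1` [set p.2].
  have cK : compact K.
    apply: (subclosed_compact _ (weight_box_compact (b:=b) (a:=a) mu_supp));
      last by move=> ? [].
    apply: closedI.
      by apply: compact_closed; [exact: norm_hausdorff|exact: weight_box_compact].
    by apply: preimage_closed; [move=> ? _; exact: cvg_snd|exact: closed_eq].
  have [||q /set_mem[Qq /= qp] qmax] := @compact_EVT_max _ _ fst K _ cK.
  - by exists p.
  - by apply: continuous_subspaceT => ?; exact: cvg_fst.
  exists q => //; split; last by rewrite /G qp.
  rewrite CE // /G; have [_ [/andP[q0 qa] qb]] := Qq.
  apply: segment_integral_eq => // y ya [|qy].
    by case/andP: ya => y0 _; rewrite ltNge y0.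
  rewrite box_extensionE // box_weight_eq0 // => Qy.
  suff : y <= q.1 by rewrite leNgt qy.
  by apply: (qmax (y, q.2)); rewrite inE.
exists M; split => // x; set x' := Num.min 0 (Num.max x b).
have -> : \int[@lebesgue_measure R]_(y in `[0, a]) m (y, x) = G (0, x').
  by apply: eq_Rintegral => y _; rewrite box_extension_clampr.
have [[y Qy]|nQ] := pselect (exists y, Q (y, x')); first exact: (MG _ Qy).
have [p Qp] := Q_neq0; apply: le_trans (MG _ Qp).
rewrite /G [leLHS](_ : _ = 0).
  by apply: Rintegral_ge0 => y _; exact: box_extension_ge0.
rewrite /Rintegral integral0_eq //= => y; rewrite in_itv /= => ya.
rewrite box_extensionE ?box_weight_eq0 //=; try exact: clampr_bound.
by move=> Qy; apply: nQ; exists y.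
Qed.

End BoxExtension.

(* The product is not recognized as a measure by the generic hints for
   almost-everywhere filters. *)
#[local] Instance lebesgue2_ae_filter (R : realType) :
  Filter (nbhs (almost_everywhere (lebesgue2 R))).
Proof. exact: (@ae_filter_ringOfSetsType _ _ R (lebesgue2 R)). Qed.

(** * Integrability and almost-everywhere comparison *)

Lemma bounded_set_finite_measure (R : realType) (S : set (R * R)) :
  measurable S -> bounded_set S -> (lebesgue2 R S < +oo)%E.
Proof.
move=> mS /ex_strict_bound_gt0[N N0 SN].
pose J : set R := `[- N, N]%classic.
apply: (@le_lt_trans _ _ (lebesgue2 R (J `*` J))).
  have mJJ : measurable (J `*` J) by apply: measurableX; exact: measurable_itv.
  apply: le_measure; rewrite ?inE //.
  move=> p Sp; have := SN p Sp; rewrite /= prod_normE gt_max => /andP[/ltW p1 /ltW p2].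
  by split; rewrite /J /= in_itv /= -ler_norml.
rewrite product_measure1E; [|exact: measurable_itv..].
have lJ : @lebesgue_measure R J = (N - - N)%:E.
  by rewrite /J lebesgue_measure_itv /= lte_fin gtrN // -EFinD.
apply: lte_mul_pinfty; first exact: measure_ge0.
  by rewrite [X in X \is a _]lJ.
by rewrite [ltLHS]lJ ltry.
Qed.

(** The integrand vanishes off the compact support, which has finite measure, and is bounded there;
    this reduces the integral over the unbounded half-plane to that set. *)
Lemma weight_integrable (R : realType) (mu g : R * R -> R) :
  {within @preisach_plane R, continuous mu} -> compact (weight_support mu) ->
  measurable_fun setT g -> (forall p, `|g p| <= 1) ->
  (lebesgue2 R).-integrable (@preisach_plane R) (EFin \o (fun p => mu p * g p)).
Proof.
move=> cmu cS mg g1.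
have SP := @weight_support_preisach R mu.
have mS : measurable (weight_support mu).
  rewrite -[X in measurable X]setCK; apply: measurableC; apply: open_measurable_prod.
  by apply: closed_openC; exact: closed_closure.
have [B muB] := weight_bounded cmu cS.
have [nu cnu nuE] := preisach_extension cmu.
apply: (integrable_mkcond _ _).2; first exact: preisach_plane_measurable.
rewrite (_ : _ \_ _ = (EFin \o (fun p => mu p * g p)) \_ (weight_support mu)); last first.
  apply/funext => p; rewrite !patchE; case: ifPn => [|/negP].
    rewrite inE => Pp; case: ifPn => // /negP; rewrite inE => Sp.
    by rewrite /= weight_support_eq0// mul0r.
  by rewrite inE => nPp; case: ifPn => //; rewrite inE => /SP.
apply: (integrable_mkcond _ _).1 => //; apply: measurable_bounded_integrable => //.
- apply: bounded_set_finite_measure => //; exact: compact_bounded.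
- apply: (eq_measurable_fun (fun p => nu p * g p)).
    by move=> p; rewrite inE => /SP Pp; rewrite nuE.
  apply: measurable_funTS; apply: measurable_funM => //.
  exact: continuous_measurable_prod.
- exists B; split; first exact: num_real.
  move=> C BC p /SP Pp; apply: le_trans (ltW BC); rewrite normrM.
  by rewrite -[B]mulr1; apply: ler_pM => //; exact: muB.
Qed.

(** Almost everywhere [f] equals its absolute value and is at most [g] restricted to [S]. It serves
    with [f] the difference of two remnant integrands, [S] a strip of the box and [g] twice the
    weight. *)
Lemma ae_dominated_Rintegral (R : realType) (D S : set (R * R)) (f g : R * R -> R) :
  measurable D -> measurable S -> (lebesgue2 R).-integrable D (EFin \o f) ->
  measurable_fun setT g -> (forall p, 0 <= g p) ->
  {ae lebesgue2 R, forall p, D p -> f p = 0 \/ S p /\ f p = g p} ->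
  0 <= \int[lebesgue2 R]_(p in D) f p /\
  ((\int[lebesgue2 R]_(p in D) f p)%:E <= \int[lebesgue2 R]_(p in S) (g p)%:E)%E.
Proof.
move=> mD mS intf mg g0 fg.
have mf : measurable_fun D f by apply/measurable_EFinP; case/integrableP: intf.
have mnf : measurable_fun D (fun p => `|f p|) by exact: measurableT_comp.
have fE : ((\int[lebesgue2 R]_(p in D) f p)%:E = \int[lebesgue2 R]_(p in D) `|f p|%:E)%E.
  rewrite fineK; last exact: integrable_fin_num.
  apply: ae_eq_integral => //; [exact/measurable_EFinP|exact/measurable_EFinP|].
  apply: filterS fg => p fgp Dp; congr EFin.
  by case: (fgp Dp) => [->|[_ ->]]; rewrite ?normr0// ger0_norm.
rewrite -lee_fin fE; split; first by apply: integral_ge0 => p _; rewrite lee_fin.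
have mgE : measurable_fun setT (EFin \o g) by exact/measurable_EFinP.
apply: (@le_trans _ _ (\int[lebesgue2 R]_(p in D `&` S) (g p)%:E)%E).
  rewrite integral_mkcondr; apply: ae_ge0_le_integral => //.
  - exact/measurable_EFinP.
  - by move=> p _; rewrite patchE; case: ifP => _; rewrite lee_fin.
  - apply: measurable_funTS; apply/(measurable_restrictT _ _).1 => //.
    exact: measurable_funS mgE.
  apply: filterS fg => p fgp Dp; rewrite patchE.
  case: (fgp Dp) => [->|[Sp ->]]; last by rewrite mem_set// ger0_norm.
  by rewrite normr0; case: ifP => _; rewrite lee_fin.
apply: ge0_subset_integral => //; first exact: measurableI.
- exact: measurable_funTS.
- by move=> p _; rewrite lee_fin.
Qed.

(** * Relays switched by a change of amplitude *)

(** In the quadrant, relays with [y < p.2] were already reset by the lower amplitude [x], so only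
    those with [x <= p.1 < y] can change, to 1. Among these, [p.2 < b] is excluded: as
    [p.1 < y <= a], the corner hypothesis gives state 1 already. *)
Lemma pulse_state_up (R : realType) (a b x y r : R) (p : R * R) :
  x < y <= a -> r = 1 \/ r = - 1 ->
  (0 <= p.1 -> p.2 <= 0 -> p.1 < a -> p.2 < b -> pulse_state x p r = 1) ->
  pulse_state y p (pulse_state x p r) - pulse_state x p r = 0 \/
  [/\ x <= p.1 < y, 0 <= p.1 <= a, b <= p.2 <= 0 &
    pulse_state y p (pulse_state x p r) - pulse_state x p r = 2].
Proof.
move=> /andP[xy ya] r1; rewrite /pulse_state.
have [p1|p1] := ltP p.1 0; first by left; lra.
have [p2|p2] := ltP 0 p.2; first by left; lra.
move=> /= /(_ isT isT); have [px|xp] := ltP p.1 x.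
  by move=> _; have [py|yp] := ltP p.1 y; [left|]; lra.
have [py|yp] := ltP p.1 y; last first.
  by move=> _; have [yp2|p2y] := ltP y p.2; case: ifP => ?; left; lra.
move=> /(_ (lt_le_trans py ya)); set s := (if _ then _ else _) => sb.
have [->|s1] : s = 1 \/ s = - 1 by rewrite /s; case: ifP => _; [right|].
  by left; lra.
right; split; rewrite ?p1 ?p2 ?(le_trans (ltW py) ya) ?andbT //; last by rewrite s1; lra.
by rewrite leNgt; apply/negP => /sb; lra.
Qed.

(** Mirror image: only relays with [y < p.2 <= x] can change, to -1, and [p.1 > a] is excluded
    because [p.2 > y >= b] makes the corner hypothesis apply. *)
Lemma pulse_state_down (R : realType) (a b x y r : R) (p : R * R) :
  b <= y < x -> r = 1 \/ r = - 1 ->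
  (0 <= p.1 -> p.2 <= 0 -> a < p.1 -> b < p.2 -> pulse_state x p r = - 1) ->
  pulse_state x p r - pulse_state y p (pulse_state x p r) = 0 \/
  [/\ y < p.2 <= x, 0 <= p.1 <= a, b <= p.2 <= 0 &
    pulse_state x p r - pulse_state y p (pulse_state x p r) = 2].
Proof.
move=> /andP[yb yx] r1; rewrite /pulse_state.
have [p1|p1] := ltP p.1 0; first by left; lra.
have [p2|p2] := ltP 0 p.2; first by left; lra.
move=> /= /(_ isT isT); have [px|xp] := ltP p.1 x.
  move=> sb; have [py|yp] := ltP p.1 y; first by left; lra.
  have [y2|y2] := ltP y p.2; last by left; lra.
  right; split; rewrite ?p1 ?p2 ?andbT //=; try lra.
have [xp2|p2x] := ltP x p.2.
  move=> _; have [py|yp] := ltP p.1 y; first lra.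
  have [y2|y2] := ltP y p.2; left; lra.
have [py|yp] := ltP p.1 y; first lra.
have [y2|y2] := ltP y p.2; last by move=> _; left; lra.
case: r1 => -> sb; last by left; lra.
right; split; rewrite ?p1 ?p2 ?andbT //=; try lra.
Qed.

Lemma relay_init_pm1 (R : realType) (L : set (R * R)) (p : R * R) :
  relay_init L p = 1 \/ relay_init L p = - 1.
Proof. by rewrite /relay_init; case: ifP => _; [left|right]. Qed.

(** An amplitude in [[b, a]] neither resets a relay with [p.2 < b] nor sets one with [p.1 > a], so
    both corners persist. Null sets enter because each new interface records the states only almost
    everywhere. *)
Lemma interface_sequence_corners (R : realType) (tau a b : R) (w : nat -> R)
    (I : nat -> set (R * R)) :
  0 < tau -> 0 < a -> b < 0 -> interface0 (I 0%N) ->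
  (forall q, I 0%N q -> (q.2 < b -> a <= q.1) /\ (a < q.1 -> q.2 <= b)) ->
  (forall k, b <= w k <= a) -> interface_sequence tau w I ->
  forall k, {ae lebesgue2 R, forall p, preisach_plane p ->
    0 <= p.1 -> p.2 <= 0 ->
    (p.1 < a -> p.2 < b -> relay_init (I k) p = 1) /\
    (a < p.1 -> b < p.2 -> relay_init (I k) p = - 1)}.
Proof.
move=> tau0 a0 b0 I0 I0ab wab Iw; elim=> [|k IHk].
  apply: filterE => p _ _ _; split; first exact: interface0_below_corner.
  exact: interface0_above_corner.
have [_ Ik] := Iw k; apply: filterS2 IHk Ik => p corner step Pp p1 p2.
have {corner} [below above] := corner Pp p1 p2; have /andP[bw wa] := wab k.
rewrite (step Pp) relay_pulse // /pulse_state (ltNge p.1 0) p1 (ltNge 0) p2 /=.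
split=> pa pb.
  by rewrite (ltNge (w k)) (ltW (lt_le_trans pb bw)) below //; case: ifP.
rewrite (ltNge p.1) (ltW (le_lt_trans wa pa)) above //=.
by case: ifP.
Qed.

(** * Comparison of consecutive remnants *)

Theorem proposition3p3 (R : realType) (tau : R) (tau_gt0 : 0 < tau)
    (mu : R * R -> R)
    (mu_cont : {within @preisach_plane R, continuous mu})
    (mu_supp : compact (weight_support mu))
    (alpha2 beta2 : R) (alpha2_gt0 : 0 < alpha2) (beta2_lt0 : beta2 < 0)
    (Q_neq0 : weight_box mu alpha2 beta2 !=set0)
    (mu_ge0 : forall p : R * R, weight_box mu alpha2 beta2 p -> 0 <= mu p)
    (I : nat -> set (R * R))
    (I0 : interface0 (I 0%N))
    (I0_box : forall p : R * R, I 0%N p ->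
      (p.2 < beta2 -> alpha2 <= p.1) /\ (alpha2 < p.1 -> p.2 <= beta2))
    (w : nat -> R)
    (w_box : forall k : nat, beta2 <= w k <= alpha2)
    (I_seq : interface_sequence tau w I) :
  exists M2 M1 : R,
    [/\ is_max (column_integral mu @` weight_box mu alpha2 beta2) M2,
        is_max (row_integral mu @` weight_box mu alpha2 beta2) M1 &
        forall k : nat,
          let Dgamma :=
            remnant mu tau (w k.+1) (I k.+1) - remnant mu tau (w k) (I k) in
          let Dw := w k.+1 - w k in
          Dw != 0 -> 0 <= Dgamma / Dw <= Num.max (2 * M2) (2 * M1)].
Proof.
have [M2 [maxM2 colM2]] :=
  column_integral_max alpha2_gt0 beta2_lt0 mu_cont mu_supp mu_ge0 Q_neq0.
have [M1 [maxM1 rowM1]] :=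
  row_integral_max alpha2_gt0 beta2_lt0 mu_cont mu_supp mu_ge0 Q_neq0.
exists M2, M1; split => // k Dgamma Dw Dw0.
(* The factor 2 is the jump of a relay between -1 and 1. *)
pose x := w k; pose y := w k.+1; pose m p := 2 * box_extension mu alpha2 beta2 p.
have cm : continuous m.
  move=> p; apply: cvgM; first exact: cvg_cst.
  exact: box_extension_continuous.
have m0 p : 0 <= m p by apply: mulr_ge0 => //; exact: box_extension_ge0.
have mm : measurable_fun setT m := continuous_measurable_prod cm.
have m2M (f : R -> R) c d N : continuous f ->
    \int[@lebesgue_measure R]_(z in `[c, d]) f z <= N ->
    \int[@lebesgue_measure R]_(z in `[c, d]) (2 * f z) <= 2 * N.
  move=> cf fN; rewrite RintegralZl //; first by rewrite ler_pM2l.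
  exact: continuous_segment_integrable.
pose F j p := relay p (fun t => w j * pulse tau t) (I j) tau.
pose h j p := mu p * F j p.
have inth j : (lebesgue2 R).-integrable (@preisach_plane R) (EFin \o h j).
  apply: weight_integrable => //; first exact: relay_pulse_measurable.
  by move=> p; exact: relay_norm_le1.
have intD i j : (lebesgue2 R).-integrable (@preisach_plane R)
    (EFin \o (fun p => h i p - h j p)).
  rewrite (_ : EFin \o _ = (EFin \o h i) \- (EFin \o h j))%E.
    by apply: integrableB => //; exact: preisach_plane_measurable.
  by apply/funext => p /=; rewrite EFinB.
have DE i j : remnant mu tau (w i) (I i) - remnant mu tau (w j) (I j) =
    \int[lebesgue2 R]_(p in @preisach_plane R) (h i p - h j p).
  by rewrite RintegralB //; exact: preisach_plane_measurable.
have corners := interface_sequence_corners tau_gt0 alpha2_gt0 beta2_lt0 I0 I0_box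
  w_box I_seq k.+1.
have [_ step] := I_seq k.
(* The states left by pulse [k] are the initial states of pulse [k.+1], so the difference of
   integrands is the weight times the change made by this single further pulse. *)
have sE p : preisach_plane p -> relay_init (I k.+1) p = F k p ->
    relay_init (I k.+1) p = pulse_state x p (relay_init (I k) p) /\
    h k.+1 p - h k p = mu p * (pulse_state y p (relay_init (I k.+1) p) -
      relay_init (I k.+1) p).
  by move=> Pp sF; rewrite /h -mulrBr -sF {1}sF /F !relay_pulse.
have /andP[bx xa] : beta2 <= x <= alpha2 := w_box k.
have /andP[byy ya] : beta2 <= y <= alpha2 := w_box k.+1.
have [xy|yx|xy] := ltgtP x y; last by move: Dw0; rewrite /Dw -/x -/y xy subrr eqxx.
(* Half-open because a pulse sets only relays with alpha strictly below its amplitude: alpha equal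
   to [x] may still switch, alpha equal to [y] may not. *)
- pose A : set R := `[x, y[%classic.
  have mA : measurable A by exact: measurable_itv.
  have lA : @lebesgue_measure R A = (y - x)%:E.
    by rewrite /A lebesgue_measure_itv /= lte_fin xy -EFinD.
  have [||ge0 le] := @ae_dominated_Rintegral R (@preisach_plane R)
    (A `*` `[beta2, 0]%classic) _ m (@preisach_plane_measurable R) _ (intD k.+1 k) mm m0.
  + by apply: measurableX => //; exact: measurable_itv.
  + apply: filterS2 corners step => p corner sF Pp.
    have [s1 ->] := sE p Pp (sF Pp); rewrite s1.
    have [|p1 p2 pa pb|->|] :=
      @pulse_state_up _ alpha2 beta2 x y _ p _ (relay_init_pm1 (I k) p).
    * by rewrite xy.
    * by rewrite -s1; case: (corner Pp p1 p2) => + _; apply.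
    * by rewrite mulr0; left.
    * move=> [pxy pa pb ->]; right; split; first by split; rewrite /A /= in_itv.
      by rewrite /m box_extensionE // mulrC.
  have {le} : Dgamma <= 2 * M2 * (y - x).
    rewrite -lee_fin EFinM -lA /Dgamma DE; apply: (le_trans le).
    apply: column_strip_integral_le => // z; apply: m2M => //.
    by apply: continuous_slicel; exact: box_extension_continuous.
  move: ge0; rewrite -DE -/Dgamma => ge0 le.
  have yx0 : 0 < Dw by rewrite subr_gt0.
  by rewrite divr_ge0 ?(ltW yx0)//= le_max ler_pdivrMr // le.
(* The remnants are subtracted in the opposite order, which makes the integrand nonnegative almost
   everywhere; negating both [Dgamma] and [Dw] leaves the quotient unchanged. *)
- pose A : set R := `]y, x]%classic.
  have mA : measurable A by exact: measurable_itv.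
  have lA : @lebesgue_measure R A = (x - y)%:E.
    by rewrite /A lebesgue_measure_itv /= lte_fin yx -EFinD.
  have [||ge0 le] := @ae_dominated_Rintegral R (@preisach_plane R)
    (`[0, alpha2]%classic `*` A) _ m (@preisach_plane_measurable R) _ (intD k k.+1) mm m0.
  + by apply: measurableX => //; exact: measurable_itv.
  + apply: filterS2 corners step => p corner sF Pp.
    have [s1 hE] := sE p Pp (sF Pp); rewrite -opprB hE -mulrN opprB s1.
    have [|p1 p2 pa pb|->|] :=
      @pulse_state_down _ alpha2 beta2 x y _ p _ (relay_init_pm1 (I k) p).
    * by rewrite byy.
    * by rewrite -s1; case: (corner Pp p1 p2) => _; apply.
    * by rewrite mulr0; left.
    * move=> [pxy pa pb ->]; right; split; first by split; rewrite /A /= in_itv.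
      by rewrite /m box_extensionE // mulrC.
  have {le} : - Dgamma <= 2 * M1 * (x - y).
    rewrite -lee_fin EFinM -lA /Dgamma opprB DE; apply: (le_trans le).
    apply: row_strip_integral_le => // z; apply: m2M => //.
    by apply: continuous_slicer; exact: box_extension_continuous.
  move: ge0; rewrite -DE -opprB -/Dgamma => ge0 le.
  have xy0 : 0 < - Dw by rewrite /Dw opprB subr_gt0.
  rewrite -[Dgamma]opprK -[Dw]opprK invrN mulrNN.
  rewrite divr_ge0 ?(ltW xy0)//= le_max; apply/orP; right.
  by rewrite ler_pdivrMr // [- Dw]opprB.
Qed.
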